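(* Let $A$ be an abelian group of order $n$. Then the number of subsets $S\subseteq A$ such that $\mathrm{Cay}(A,S)$ is not a DRR is at most $2^{3n/4+2(\log_2 n)^2+1}$.
   Context: All groups and digraphs are finite. A digraph is a pair $(V,R)$ with $V$ finite nonempty and $R\subseteq V\times V$ (loops allowed). For a group $G$ and $S\subseteq G$, the Cayley digraph $\mathrm{Cay}(G,S)$ has vertex set $G$, with $(g,h)$ an arc iff $gh^{-1}\in S$. $G$ acts regularly on it by right multiplication, and $\mathrm{Cay}(G,S)$ is a DRR if its full automorphism group equals this right regular action of $G$. *)

(* Defs.v *)
From HB Require Import structures.
From mathcomp Require Import all_boot all_fingroup.
From Stdlib Require Import Reals.
Set Implicit Arguments. Unset Strict Implicit. Unset Printing Implicit Defensive.

Section Cayley.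
Variable gT : finGroupType.
Local Open Scope group_scope.

Definition cay_arc (S : {set gT}) (g h : gT) : bool := g * h^-1 \in S.

Definition cay_aut (S : {set gT}) : {set {perm gT}} :=
  [set p : {perm gT} | [forall g, forall h, cay_arc S (p g) (p h) == cay_arc S g h]].

Definition right_regular : {set {perm gT}} :=
  [set p : {perm gT} | [exists a, [forall x, p x == x * a]]].

Definition is_DRR (S : {set gT}) : bool := cay_aut S == right_regular.
End Cayley.

Definition log2R (x : R) : R := (ln x / ln 2)%R.

(* Main.v *)
(** If [Cay(A, S)] is not a DRR then the right regular group [R] is proper in
    [C := Aut(Cay(A, S))].  Either some element of [C] outside [R] normalises
    [R], and then a nontrivial automorphism of [A] preserves [S]; or [R] is
    self-normalising in [C].  In the second case let [B] be a minimal overgroup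
    of [R] in [C].  Distinct conjugates of [R] in [B] meet in [Z := Z(B)], so
    [B / Z] is a Frobenius group with complement [R / Z], and its kernel is an
    abelian [p]-group by maximality of [R].  Comparing, inside the abelian
    preimage of the kernel, the two complements of [Z] given by the stabiliser of
    a point and by the commutator subgroup with [R], one finds [z != 1] in [Z]
    such that [S] is invariant under translation by [z] outside [Z].
    In both cases [S] is invariant under a permutation whose fixed points form a
    proper subgroup, which leaves at most [2 ^ (3n/4)] choices for [S].  Since
    every subgroup of [A] is generated by [log2 n] elements, there are at most
    [n ^ log2 n] automorphisms and [n * n ^ log2 n] pairs [(Z, z)]. *)

Require Import Defs.
From HB Require Import structures.
From mathcomp Require Import all_boot all_fingroup all_solvable.
From mathcomp Require Import vcharacter.
Set Implicit Arguments. Unset Strict Implicit. Unset Printing Implicit Defensive.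

(** * Frobenius structure modulo the centre *)

Section FrobeniusQuotient.
Local Open Scope group_scope.
Variables (gT : finGroupType) (A B : {group gT}).
Hypotheses (maxA : maximal A B) (abA : abelian A) (selfA : 'N_B(A) \subset A).

Lemma center_sub_self_normalizing : 'Z(B) \subset A.
Proof.
apply: subset_trans selfA; apply: setIS; apply: subset_trans (cent_sub _).
exact: centS (proper_sub (maxgroupp maxA)).
Qed.

(** An element [a] of [A] lying also in [A :^ b] is centralised by both of these abelian groups. If
    [b] is outside [A], self-normalisation gives [A :^ b != A], so by maximality the two generate
    [B] and [a] is central. *)
Lemma Frobenius_quotient_center : [Frobenius B / 'Z(B) with complement A / 'Z(B)].
Proof.
have prAB := maxgroupp maxA; have sAB := proper_sub prAB.
have sZA := center_sub_self_normalizing; have nsZ := center_normal B.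
have nZB := normal_norm nsZ; have nZA := subset_trans sAB nZB.
have nsZA : 'Z(B) <| A by rewrite /normal sZA.
have neAB : A / 'Z(B) != B / 'Z(B).
  apply: contra (proper_subn prAB) => /eqP eAB.
  by rewrite -(quotientSGK nZB sZA) eAB.
have AneZ : ~~ (A \subset 'Z(B)).
  apply/negP => sAZ; case/negP: (proper_subn prAB).
  apply: subset_trans selfA; rewrite subsetI subxx.
  by rewrite (_ : A :=: 'Z(B)) //; apply/eqP; rewrite eqEsubset sAZ.
apply/andP; split=> //; apply/normedTI_P; split.
- by rewrite setD_eq0 quotient_sub1.
- by rewrite subsetI quotientS // normD1 normG.
move=> _ /morphimP[b nZb Bb ->] /pred0Pn[x /andP[/= /setD1P[]]].
move=> ntx /morphimP[a nZa Aa defx]; move: ntx; rewrite {x}defx => nta.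
rewrite conjD1g => /setD1P[_]; rewrite mem_conjg -morphV // -morphJ ?groupV //.
have nZab : a ^ b^-1 \in 'N('Z(B)) by rewrite groupJ ?groupV.
move=> Aab; have {}Aab : a ^ b^-1 \in A.
  by rewrite -(quotientGK nsZA); apply/morphpreP.
apply: mem_quotient; apply: contraR nta => Ab.
have defB : A <*> A :^ b = B.
  have [] := maxgroupP maxA => _ maxA'.
  apply/eqP; rewrite eqEproper join_subG sAB /= -{1}(conjGid Bb) conjSg sAB /=.
  apply/negP => prJ; have defA := maxA' _ prJ (joing_subl _ _).
  case/negP: Ab; apply: (subsetP selfA); rewrite inE Bb inE.
  by have := joing_subr A (A :^ b); rewrite defA.
suff: a \in 'Z(B) by move=> Za; rewrite /= coset_id.
rewrite inE (subsetP sAB) //= -defB centY inE.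
apply/andP; split; first by rewrite (subsetP abA).
by rewrite centJ mem_conjg (subsetP abA).
Qed.
End FrobeniusQuotient.

(** * Abelian maximal subgroups with a non-normal complement *)

Section Wreath.
Local Open Scope group_scope.
Variables (gT : finGroupType) (A B H : {group gT}).
Hypotheses (maxA : maximal A B) (abA : abelian A) (selfA : 'N_B(A) \subset A).
Hypotheses (defB : A * H = B) (tiAH : A :&: H = 1) (nnH : ~~ (B \subset 'N(H))).
Let Z := 'Z(B)%G.

(** The Frobenius kernel is a normal Hall subgroup of the same order as [H / Z], so the two
    coincide. Once the kernel is abelian, so are its isomorphic copy [H] and [Z * H]. *)
Lemma Frobenius_kernel_preimage :
  exists K : {group gT}, [/\ [Frobenius B / Z = (K / Z) ><| (A / Z)],
    Z * H = K, K <| B & abelian K].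
Proof.
have prAB := maxgroupp maxA; have sAB := proper_sub prAB.
have sZA : Z \subset A := center_sub_self_normalizing maxA selfA.
have nsZ : Z <| B := center_normal B.
have nZB := normal_norm nsZ; have nZA := subset_trans sAB nZB.
have sHB : H \subset B by rewrite -defB mulG_subr.
have nZH := subset_trans sHB nZB.
have tiZH : Z :&: H = 1 by apply/trivgP; rewrite -tiAH setSI.
have [Kb frobB] := Frobenius_kernel_exists (Frobenius_quotient_center maxA abA selfA).
have [sdB ntKb ntAb prKb _] := Frobenius_context frobB.
have [_ mulB nKA tiKA] := sdprodP sdB.
have [nsKb sAb _ _ _] := sdprod_context sdB.
have coKA := Frobenius_coprime frobB.
have isoH : H / Z \isog H by rewrite isog_sym quotient_isog.
have cardH : #|H / Z| = #|Kb|.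
  rewrite (card_isog isoH); apply/eqP; rewrite -(eqn_pmul2l (cardG_gt0 A)).
  rewrite -TI_cardMg // defB -(Lagrange (normal_sub nsZ)) -(Lagrange sZA).
  by rewrite -!card_quotient // -(sdprod_card sdB) -mulnA [(#|Kb| * _)%N]mulnC.
have hallK : \pi(Kb).-Hall(B / Z) Kb by apply/Hall_pi/(Frobenius_ker_Hall frobB).
have defKb : H / Z = Kb.
  apply/eqP; rewrite eqEcard cardH leqnn andbT.
  by rewrite (sub_normal_Hall hallK) ?quotientS // /pgroup /= cardH pnat_pi.
have abKb : abelian Kb.
  have [p p_pr pKb] : exists2 p, prime p & p %| #|Kb|.
    by exists (pdiv #|Kb|); rewrite ?pdiv_dvd ?pdiv_prime ?cardG_gt1.
  (* Maximality of [A]: the preimage of [M <*> (A / Z)] lies between [A] and [B], so it is one of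
     the two. *)
  have minK : forall M : {group coset_of Z}, M \subset Kb -> M :!=: 1 ->
      A / Z \subset 'N(M) -> M :=: Kb.
    move=> M sMK ntM nMA.
    have sMB : M \subset B / Z by rewrite (subset_trans sMK) ?(proper_sub prKb).
    have [maxB maxA'] := maxgroupP maxA.
    pose J := (coset Z @*^-1 (M <*> (A / Z)))%G.
    have sAJ : A \subset J.
      by rewrite -sub_morphim_pre // joing_subr.
    have sJB : J \subset B.
      by rewrite -(quotientGK nsZ) morphpreS // join_subG sMB quotientS.
    have defJ : J / Z = M * (A / Z) by rewrite cosetpreK /= norm_joinEr.
    have [eJ | neJ] := eqVneq (J : {set gT}) B.
      apply/eqP; rewrite eqEcard sMK -(leq_pmul2r (cardG_gt0 (A / Z))).
      rewrite (sdprod_card sdB) -TI_cardMg.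
        by rewrite -defJ eJ /=.
      by apply/trivgP; rewrite -tiKA setSI.
    case/negP: ntM; rewrite -subG1 -tiKA subsetI sMK.
    have defA : J :=: A by apply: maxA'; rewrite ?properEneq ?neJ.
    have : M \subset J / Z by rewrite defJ mulG_subl.
    by rewrite defA.
  have nKbA : A / Z \subset 'N(Kb) := nKA.
  (* Coprime action gives an invariant Sylow subgroup, so by [minK] the kernel is a [p]-group; its
     centre is nontrivial and invariant, so [minK] applies again. *)
  have [P sylP nPA] := sol_coprime_Sylow_exists p
    (abelian_sol (quotient_abelian Z abA)) nKbA coKA.
  have defP : P :=: Kb.
    apply: minK => //; first exact: pHall_sub sylP.
    by rewrite -cardG_gt1 (card_Hall sylP) p_part_gt1 mem_primes p_pr cardG_gt0.
  have pgK : p.-group Kb by rewrite -defP (pHall_pgroup sylP).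
  have <- : 'Z(Kb) = Kb.
    apply: (minK 'Z(Kb)%G) => //; first exact: center_sub.
      by apply: contra ntKb => /eqP/(trivg_center_pgroup pgK)->.
    exact: char_norm_trans (center_char Kb) nKbA.
  exact: center_abelian.
have defK : Z * H = (coset Z @*^-1 Kb)%G by rewrite /= -defKb quotientK.
exists (coset Z @*^-1 Kb)%G; split=> //.
- by rewrite /= cosetpreK.
- by rewrite -(quotientGK nsZ) cosetpre_normal.
have abH : abelian H by rewrite -(isog_abelian isoH) /= defKb.
rewrite /= -defKb quotientK // abelianM center_abelian abH /=.
by rewrite (subset_trans sHB) // centsC subsetIr.
Qed.

(* When [H] is a point stabiliser, evaluating [h ^ a * z] at that point shows
   that [h] acts on the point moved by [a^-1] as translation by [z^-1]. *)
Lemma central_twist :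
  exists z, [/\ z \in Z, z != 1 &
    forall a, a \in A -> a \notin Z -> exists2 h, h \in H & h ^ a * z \in H].
Proof.
have [K [frobB defK nsKB abK]] := Frobenius_kernel_preimage.
have prAB := maxgroupp maxA; have sAB := proper_sub prAB.
have sZA : Z \subset A := center_sub_self_normalizing maxA selfA.
have nsZ : Z <| B := center_normal B.
have nZB := normal_norm nsZ; have nZA := subset_trans sAB nZB.
have sHB : H \subset B by rewrite -defB mulG_subr.
have nZH := subset_trans sHB nZB.
have [sHK sZK] : H \subset K /\ Z \subset K by rewrite -defK mulG_subl mulG_subr.
have tiZH : Z :&: H = 1 by apply/trivgP; rewrite -tiAH setSI.
have cardK : #|K| = (#|Z| * #|H|)%N by rewrite -defK TI_cardMg.
have nKA : A \subset 'N(K) := subset_trans sAB (normal_norm nsKB).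
pose pi := \pi(H) : nat_pred.
(* [Q] covers [A / Z] and is coprime to [P], so [[~: P, Q]] is a complement of
   [Z] in [K] consisting, for each [a] outside [Z], of commutators with [a]. *)
pose P := 'O_pi(K)%G; pose Q := 'O_pi^'(A)%G.
have sHP : H \subset P.
  by rewrite pcore_max ?pgroup_pi // /normal sHK sub_abelian_norm.
have sPK : P \subset K := pcore_sub _ _.
have sQA : Q \subset A := pcore_sub _ _.
have abP : abelian P := abelianS sPK abK.
have nPA : A \subset 'N(P) := char_norm_trans (pcore_char _ _) nKA.
have nPQ : Q \subset 'N(P) := subset_trans sQA nPA.
have coPQ : coprime #|P| #|Q|.
  exact: pnat_coprime (pcore_pgroup _ _) (pcore_pgroup _ _).
have cardHq : #|K / Z| = #|H|.
  by rewrite card_quotient ?(subset_trans (normal_sub nsKB)) // -divgS // cardK mulKn.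
(* The [pi]-part of [A] is trivial modulo [Z], because [#|A / Z|] is coprime to
   [#|K / Z| = #|H|]. *)
have defA : A \subset Z * Q.
  have /dprodP[_ <- _ _] := nilpotent_pcoreC pi (abelian_nil abA).
  apply: mulSg; rewrite -quotient_sub1 ?(subset_trans (pcore_sub _ _)) //.
  rewrite -(setIidPr (quotientS Z (pcore_sub pi A))) coprime_TIg //.
  rewrite coprime_sym (@pnat_coprime pi) //.
    exact: quotient_pgroup (pcore_pgroup _ _).
  have := Frobenius_coprime frobB; rewrite /= cardHq => co.
  by have := co; rewrite coprime_pi'.
pose V := [~: P, Q]%G.
have sVP : V \subset P by rewrite commg_subl.
have sVK := subset_trans sVP sPK.
(* In a coprime action on the abelian group [P], [[~: P, Q]] meets ['C_P(Q)] trivially, and [Z]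
   centralises [Q]. *)
have tiVZ : V :&: Z = 1.
  apply/trivgP; rewrite -(coprime_abel_cent_TI nPQ coPQ abP) setIS //.
  by rewrite centsC (subset_trans sQA) // (subset_trans sAB) // centsC subsetIr.
have commV h a : h \in H -> a \in A -> [~ h, a] \in V.
  move=> Hh /(subsetP defA)/mulsgP[z q Zz Qq ->].
  have /centerP[_ cz] := Zz; rewrite commgMJ.
  have -> : [~ h, z] = 1 by apply/eqP/commgP/commute_sym/cz/(subsetP sHB).
  by rewrite conj1g mulg1 mem_commg ?(subsetP sHP).
have cardV : #|V| <= #|H|.
  rewrite -(leq_pmul2l (cardG_gt0 Z)) -cardK mulnC -TI_cardMg //.
  by rewrite subset_leq_card // mul_subG.
(* Equal commutators make [k * h^-1] commute with [a]; the Frobenius action is fixed-point-free, so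
   [k * h^-1] lies in [Z :&: H = 1]. *)
have injc a : a \in A -> a \notin Z -> {in H &, injective (fun h => [~ h, a])}.
  move=> Aa nZa h k Hh Hk eqhk.
  have Na := subsetP nZA _ Aa; have Hkh : k * h^-1 \in H by rewrite groupM ?groupV.
  have Nkh := subsetP nZH _ Hkh.
  have ckh : (k * h^-1) ^ a = k * h^-1.
    rewrite conjMg conjVg -(mulKVg k (k ^ a)) -(mulKVg h (h ^ a)) -!commgEl /= eqhk.
    by rewrite invMg mulgA mulgK.
  have : coset Z (k * h^-1) \in 'C_(K / Z)[coset Z a].
    rewrite inE mem_quotient ?(subsetP sHK) //=.
    by apply/cent1P/commgP/conjg_fixP; rewrite -morphJ ?ckh.
  rewrite (Frobenius_reg_ker frobB); last first.
    rewrite !inE mem_quotient // andbT.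
    by apply: contra nZa => /eqP/coset_idr->.
  move/set1P/(coset_idr Nkh) => Zkh; have : k * h^-1 \in Z :&: H by rewrite inE Zkh.
  by rewrite tiZH => /set1P/eqP; rewrite -eq_mulgV1 => /eqP.
have commV_onto a : a \in A -> a \notin Z -> [set [~ h, a] | h in H] = V.
  move=> Aa nZa; apply/eqP; rewrite eqEcard (card_in_imset (injc a Aa nZa)) cardV andbT.
  by apply/subsetP=> _ /imsetP[h Hh ->]; apply: commV.
have [a0 Aa0 nZa0] : exists2 a, a \in A & a \notin Z.
  apply/subsetPn; apply/negP=> sAZ; case/negP: (proper_subn prAB).
  have eA : A :=: Z by apply/eqP; rewrite eqEsubset sAZ.
  by rewrite (subset_trans _ selfA) // subsetI subxx /= eA normal_norm.
(* Otherwise [H = V] by cardinality, and [V] is normalised by both [A] and [H], hence by [B]. *)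
have [v Vv nHv] : exists2 v, v \in V & v \notin H.
  apply/subsetPn; apply: contra nnH => sVH.
  have eVH : V :=: H.
    apply/eqP; rewrite eqEcard sVH -(commV_onto a0) //.
    by rewrite (card_in_imset (injc a0 Aa0 nZa0)) /=.
  rewrite -eVH -defB mul_subG //.
    by rewrite normsR // (subset_trans _ (normal_norm (pcore_normal _ _))).
  exact: subset_trans sHP (sub_abelian_norm abP sVP).
have : v \in K by apply: (subsetP sVK).
rewrite -defK => /mulsgP[z h Zz Hh defv].
(* With [v = z * h = [~ k, a]], one gets [k ^ a = k * z * h], so multiplying by [z^-1] leaves
   [k * h] in [H]. *)
exists z^-1; split; first by rewrite groupV.
  by rewrite invg_eq1; apply: contra nHv => /eqP z1; rewrite defv z1 mul1g.
move=> a Aa nZa; move: Vv; rewrite -(commV_onto a) // => /imsetP[k Hk defvk].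
exists k => //.
have -> : k ^ a = k * z * h by rewrite -mulgA -defv defvk commgEl mulKVg.
have /centerP[_ cz] := Zz.
by rewrite -!mulgA (mulgA z) cz ?(subsetP sHB) // mulgK groupM.
Qed.
End Wreath.

(** * From a failed DRR to a symmetry of the connection set *)

Section CayleyGroups.
Local Open Scope group_scope.
Variable gT : finGroupType.
Implicit Types (S : {set gT}) (a x : gT).

Definition rtrans a : {perm gT} := perm (mulIg a).

Lemma rtransE a x : rtrans a x = x * a.
Proof. by rewrite permE. Qed.

Lemma rtransM : {in [set: gT] &, {morph rtrans : a b / a * b}}.
Proof. by move=> a b _ _; apply/permP=> x; rewrite permM !rtransE mulgA. Qed.
Canonical rtrans_morphism := Morphism rtransM.

Lemma right_regularE : right_regular gT = rtrans @* [set: gT].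
Proof.
apply/setP=> p; rewrite inE morphimEdom.
apply/existsP/imsetP=> [[a /forallP pa]|[a _ ->]].
  by exists a; rewrite ?inE //; apply/permP=> x; rewrite rtransE (eqP (pa x)).
by exists a; apply/forallP=> x; rewrite rtransE.
Qed.

Lemma cay_autP S (p : {perm gT}) :
  reflect (forall g h, (p g * (p h)^-1 \in S) = (g * h^-1 \in S)) (p \in cay_aut S).
Proof.
rewrite inE; apply: (iffP forallP) => [pS g h|pS g]; last first.
  by apply/forallP=> h; rewrite /cay_arc pS.
by have /forallP/(_ h)/eqP := pS g.
Qed.

Lemma cay_aut_group_set S : group_set (cay_aut S).
Proof.
apply/group_setP; split; first by apply/cay_autP=> g h; rewrite !perm1.
by move=> p q /cay_autP pS /cay_autP qS; apply/cay_autP=> g h; rewrite !permM qS pS.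
Qed.
Canonical cay_aut_group S := Group (cay_aut_group_set S).

Lemma rtrans_sub_cay_aut S : rtrans @* [set: gT] \subset cay_aut S.
Proof.
apply/subsetP=> _ /morphimP[a _ _ ->]; apply/cay_autP=> g h /=.
by rewrite !rtransE invMg mulgA mulgK.
Qed.

Lemma cay_aut_fix1 S (p : {perm gT}) :
  p \in cay_aut S -> p 1 = 1 -> forall x, (p x \in S) = (x \in S).
Proof. by move=> /cay_autP pS p1 x; have := pS x 1; rewrite p1 invg1 !mulg1. Qed.

(** Conjugation by [q] turns translation by [a] into translation by some [a']; evaluating at 1
    identifies [a'] with [q a]. *)
Lemma normalizer_fix1_Aut (q : {perm gT}) :
  q \in 'N(rtrans @* [set: gT]) -> q 1 = 1 -> q \in Aut [set: gT].
Proof.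
move=> Nq q1; rewrite inE; apply/andP; split.
  by apply/subsetP=> x _; rewrite inE.
apply/morphicP=> x a _ _.
have : rtrans a ^ q \in rtrans @* [set: gT].
  by rewrite memJ_norm // mem_morphim ?inE.
case/morphimP=> a' _ _ /= eqa.
have qa y : q (y * a) = q y * a'.
  have := congr1 (fun p : {perm gT} => p (q y)) eqa.
  by rewrite /conjg !permM permK !rtransE.
by rewrite qa; have := qa 1; rewrite mul1g q1 mul1g => ->.
Qed.

Lemma not_DRR_symmetry S : abelian [set: gT] -> ~~ is_DRR S ->
    (exists2 p, p \in (Aut [set: gT])^# & forall x, (p x \in S) = (x \in S))
  \/ (exists L : {group gT}, exists z,
       [/\ L \proper [set: gT], z \in L, z != 1 &
           forall x, x \notin L -> (x * z \in S) = (x \in S)]).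
Proof.
move=> abT; rewrite /is_DRR right_regularE => neCR.
pose R := (rtrans @* [set: gT])%G; pose C := cay_aut_group S.
have sRC : R \subset C := rtrans_sub_cay_aut S.
have prRC : R \proper C by rewrite properEneq eq_sym neCR.
have abR : abelian R by apply: morphim_abelian.
have Rt a : rtrans a \in R by rewrite mem_morphim ?inE.
have [sNR | /subsetPn[p /setIP[Cp Np] nRp]] := boolP ('N_C(R) \subset R);
  [right | left].
  have [B /mingroupP[prRB minB] sBC] : {B : {group {perm gT}} |
      [min B | R \proper B] & B \subset C} by apply: mingroup_exists.
  have maxR : maximal R B.
    apply/maxgroupP; split=> // M prM sRM; apply/eqP; apply: contraT => neRM.
    have eMB := minB M _ (proper_sub prM).
    by rewrite eMB ?properxx // in prM; rewrite properEneq eq_sym neRM.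
  have selfR : 'N_B(R) \subset R := subset_trans (setSI _ sBC) sNR.
  (* Since [R] is regular, the stabiliser of 1 in [B] is a complement of [R]. *)
  pose H := 'C_B[1 | 'P]%G.
  have H1 h : h \in H -> h 1 = 1 by case/setIP=> _ /astab1P.
  have sRB := proper_sub prRB.
  have memH h : h \in B -> h 1 = 1 -> h \in H.
    by move=> Bh h1; rewrite inE Bh; apply/astab1P.
  have defB : R * H = B.
    apply/eqP; rewrite eqEsubset mul_subG ?subsetIl //=.
    apply/subsetP=> b Bb; rewrite -(mulKg (rtrans (b^-1 1)) b).
    rewrite mem_mulg ?groupV // memH ?groupM ?(subsetP sRB _ (Rt _)) //.
    by rewrite permM rtransE mul1g permKV.
  have tiRH : R :&: H = 1.
    apply/trivgP/subsetP=> _ /setIP[/morphimP[a _ _ ->] /H1].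
    by rewrite rtransE mul1g => ->; rewrite morph1 inE.
  (* A normal point stabiliser of a transitive group fixes every point; it would be trivial, forcing
     [B = R]. *)
  have nnH : ~~ (B \subset 'N(H)).
    apply: contra (proper_subn prRB) => nHB; rewrite -defB.
    suff /trivgP-> : H \subset [1] by rewrite mulg1.
    apply/subsetP=> h Hh; rewrite inE; apply/eqP/permP=> a; rewrite perm1.
    have : h ^ (rtrans a)^-1 \in H.
      by rewrite memJ_norm // (subsetP nHB) // groupV (subsetP sRB).
    move/H1; rewrite /conjg invgK !permM rtransE mul1g => ha.
    by rewrite -[h a](permKV (rtrans a)) ha rtransE mul1g.
  have [z0 [Zrz nz tw]] := central_twist maxR abR selfR defB tiRH nnH.
  have sZR := center_sub_self_normalizing maxR selfR.
  have /morphimP[z _ _ /= defz] := subsetP sZR _ Zrz; rewrite {z0}defz in Zrz nz tw.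
  exists (rtrans @*^-1 'Z(B))%G, z^-1; split.
  - rewrite properE subsetT; apply: contra (proper_subn prRB) => sZ.
    have sRZ : R \subset 'Z(B) by rewrite sub_morphim_pre.
    have eR : R :=: 'Z(B) by apply/eqP; rewrite eqEsubset sRZ.
    apply: subset_trans selfR; rewrite subsetI subxx /= [X in 'N(X)]eR.
    exact: normal_norm (center_normal B).
  - by rewrite groupV; apply/morphpreP; rewrite inE.
  - by rewrite invg_eq1; apply: contra nz => /eqP->; rewrite morph1.
  (* Applied to the inverse of translation by [x], the twist says [h x = x * z^-1]; as [h] fixes 1,
     it preserves [S]. *)
  move=> x nLx; have [||h Hh] := tw (rtrans x)^-1.
  - by rewrite groupV.
  - by rewrite groupV; apply: contra nLx => Zx; apply/morphpreP; rewrite inE.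
  move/H1; rewrite permM /conjg invgK !permM !rtransE mul1g => hx.
  rewrite -(cay_aut_fix1 (subsetP sBC _ _) (H1 h Hh) x); last by case/setIP: Hh.
  congr (_ \in S); rewrite -[h x](permKV (rtrans x)) rtransE.
  by rewrite (canRL (mulgK z) hx) mul1g (centsP abT) ?inE.
(* Correcting [p] by a translation makes it fix 1 without leaving the normaliser of [R]; it stays
   nontrivial since [p] is not in [R]. *)
pose q := p * rtrans ((p 1)^-1).
have q1 : q 1 = 1 by rewrite permM rtransE mulgV.
have Cq : q \in C by rewrite groupM ?(subsetP sRC _ (Rt _)).
exists q; last exact: cay_aut_fix1 Cq q1.
have Nq : q \in 'N(R) by rewrite groupM // (subsetP (normG _)) ?Rt.
rewrite in_setD1 normalizer_fix1_Aut // andbT; apply: contra nRp => /eqP eq1.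
by rewrite -[p](mulgK (rtrans ((p 1)^-1))) -/q eq1 mul1g groupV Rt.
Qed.
End CayleyGroups.

(** * Counting sets invariant under a permutation *)

Section InvariantSets.
Variables (T : finType) (s : {perm T}).

(** An invariant set is a union of cycles, so it is determined by the cycles it meets. *)
Lemma card_invariant_sets :
  #|[set S : {set T} | [forall x, (s x \in S) == (x \in S)]]| <= 2 ^ #|porbits s|.
Proof.
rewrite -card_powerset.
have injP : {in [set S : {set T} | [forall x, (s x \in S) == (x \in S)]] &,
             injective (fun S : {set T} => porbit s @: S)}.
  have memP (S : {set T}) x : [forall x, (s x \in S) == (x \in S)] ->
      (porbit s x \in porbit s @: S) = (x \in S).
    move=> /forallP sS; apply/imsetP/idP=> [[y Sy /eqP]|]; last by exists x.
    rewrite eq_porbit_mem => /porbitP[i ->].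
    elim: i => [|i IHi]; first by rewrite expg0 perm1.
    by rewrite expgSr permM (eqP (sS _)).
  move=> S1 S2; rewrite !inE => S1s S2s eqS; apply/setP=> x.
  by rewrite -(memP S1) // eqS memP.
rewrite -(card_in_imset injP); apply/subset_leq_card/subsetP=> _ /imsetP[S _ ->].
by rewrite inE imsetS //; apply/subsetP.
Qed.

(** Each cycle contributes at least 2 on the right: a fixed point is counted in both terms, and any
    other cycle has two points. *)
Lemma card_porbits_fix : #|porbits s| * 2 <= #|T| + #|[set x | s x == x]|.
Proof.
rewrite -[#|T|]sum1_card -[#|[set _ | _]|]sum1_card (partition_big_imset (porbit s)) /=.
have -> : \sum_(x in [set x | s x == x]) 1 =
    \sum_(C in porbits s) \sum_(x in [set x | s x == x] | porbit s x == C) 1.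
  by apply: partition_big => x _; apply: imset_f.
rewrite -big_split -sum_nat_const; apply: leq_sum => _ /imsetP[x _ ->] /=.
have [sx|sx] := eqVneq (s x) x.
  by rewrite (bigD1 x) //= [X in _ + X](bigD1 x) /= ?inE ?sx ?eqxx // addnACA leq_addr.
rewrite (bigD1 x) //= (bigD1 (s x)) /=; last first.
  by rewrite sx andbT eq_porbit_mem (mem_porbit s 1).
by rewrite addnA -addnA leq_addr.
Qed.

(** With at most half of the points fixed, there are at most [(#|T| + #|T| / 2) / 2] cycles. *)
Lemma card_invariant_sets_le : #|[set x | s x == x]| * 2 <= #|T| ->
  #|[set S : {set T} | [forall x, (s x \in S) == (x \in S)]]| <= 2 ^ (3 * #|T| %/ 4).
Proof.
move=> fix2; apply: leq_trans card_invariant_sets _; rewrite leq_exp2l //.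
rewrite leq_divRL // (mulnA _ 2 2) (leq_trans (leq_mul card_porbits_fix (leqnn 2))) //.
by rewrite mulnDl (leq_trans (leq_add (leqnn _) fix2)) // -mulnSr mulnC.
Qed.
End InvariantSets.

(** * Counting subgroups and automorphisms by generators *)

Section GeneratingTuples.
Local Open Scope group_scope.
Variable gT : finGroupType.
Notation k := (trunc_log 2 #|gT|).

(** Each generator chosen outside the subgroup generated so far at least doubles its order. *)
Lemma small_generating_tuple (G : {group gT}) :
  exists t : k.-tuple gT, <<[set x in t]>> = G.
Proof.
have gen m : exists t : m.-tuple gT, <<[set x in t]>> \subset G /\
    (<<[set x in t]>> = G \/ 2 ^ m <= #|<<[set x in t]>>|).
  elim: m => [|m [t [stG gent]]].
    exists [tuple]; rewrite gen_subG; split; last by right; apply: cardG_gt0.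
    by apply/subsetP=> x; rewrite inE.
  have consE x : [set y in [tuple of x :: t]] = x |: [set y in t].
    by apply/setP=> y; rewrite !inE.
  have [eqG | neG] := eqVneq <<[set x in t]>> (G : {set gT}).
    (* Padding with 1 keeps the tuple length exact once [G] is reached. *)
    exists [tuple of 1 :: t]; rewrite consE; have -> : <<1 |: [set x in t]>> = G.
      rewrite -eqG; apply/eqP; rewrite eqEsubset.
      rewrite gen_subG subUset sub1set group1 subset_gen /=.
      by rewrite genS ?subsetUr.
    by split=> //; left.
  have /subsetPn[x Gx ntx] : ~~ (G \subset <<[set x in t]>>).
    by apply: contra neG => sGt; rewrite eqEsubset stG.
  exists [tuple of x :: t]; rewrite consE; split.
    by rewrite gen_subG subUset sub1set Gx -gen_subG.
  right; case: gent => [eqG|le2]; first by rewrite eqG eqxx in neG.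
  have prt : <<[set y in t]>> \proper <<x |: [set y in t]>>.
    rewrite properE genS ?subsetUr //=; apply: contra ntx => /subsetP-> //.
    by rewrite mem_gen // setU11.
  rewrite expnS mulnC -(Lagrange (proper_sub prt)) leq_mul //.
  by rewrite indexg_gt1 proper_subn.
have [t [stG [tG|le2]]] := gen k; exists t => //; apply/eqP; rewrite eqEproper stG /=.
apply/negP=> prt; have := trunc_log_ltn #|gT| (isT : 1 < 2).
rewrite ltnNge => /negP; apply; rewrite expnS mulnC.
apply: leq_trans (max_card G); rewrite -(Lagrange (proper_sub prt)).
by rewrite leq_mul // indexg_gt1 proper_subn.
Qed.

Lemma card_subgroups_le : #|{group gT}| <= #|gT| ^ k.
Proof.
rewrite -card_tuple.
have surj : [set: {group gT}] \subset [set <<[set x in t]>>%G | t : k.-tuple gT].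
  apply/subsetP=> G _; have [t tG] := small_generating_tuple G.
  by apply/imsetP; exists t => //; apply/val_inj.
by rewrite -cardsT (leq_trans (subset_leq_card surj)) // leq_imset_card.
Qed.

(** Used twice: automorphisms agreeing on generators are equal, and, with [q = 1], the fixed points
    of an automorphism form a subgroup. *)
Lemma Aut_equalizer_group_set (p q : {perm gT}) :
  p \in Aut [set: gT] -> q \in Aut [set: gT] -> group_set [set x | p x == q x].
Proof.
move=> Ap Aq; apply/group_setP; split=> [|x y]; rewrite !inE.
  by rewrite -(autmE Ap) -(autmE Aq) !morph1.
move=> /eqP px /eqP py.
rewrite (morphicP (Aut_morphic Ap)) ?inE //.
by rewrite (morphicP (Aut_morphic Aq)) ?inE // px py.
Qed.

Lemma card_Aut_le : #|Aut [set: gT]| <= #|gT| ^ k.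
Proof.
have [t tG] := small_generating_tuple [set: gT]%G.
have inj : {in Aut [set: gT] &, injective (fun p : {perm gT} => map_tuple p t)}.
  move=> p q Ap Aq /(congr1 val)/= eqpq; apply/permP=> x.
  pose E := Group (Aut_equalizer_group_set Ap Aq).
  have : <<[set x in t]>> \subset E.
    rewrite gen_subG; apply/subsetP=> y; rewrite !inE => /(nthP 1)[i ltit <-].
    by have := congr1 (nth 1 ^~ i) eqpq; rewrite !(nth_map 1) // => ->.
  by rewrite tG => /subsetP/(_ x); rewrite !inE => /(_ isT)/eqP.
rewrite -(card_in_imset inj) (leq_trans (max_card _)) ?card_tuple //.
Qed.

Lemma card_proper_subgroup (L : {group gT}) : L \proper [set: gT] -> #|L| * 2 <= #|gT|.
Proof.
move=> prL; rewrite -cardsT -(Lagrange (proper_sub prL)) leq_mul //.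
by rewrite indexg_gt1 proper_subn.
Qed.
End GeneratingTuples.

(** * Union bound over the possible symmetries *)

Section CountingNonDRR.
Local Open Scope group_scope.
Variable gT : finGroupType.
Notation k := (trunc_log 2 #|gT|).

(* The test on [u.2] makes this a permutation for every pair [u]. *)
Definition coset_shift (u : {group gT} * gT) x :=
  if (x \in u.1) || (u.2 \notin u.1) then x else x * u.2.

Lemma coset_shift_inj u : injective (coset_shift u).
Proof.
case: u => L z x y; rewrite /coset_shift /=; have [Lz|_] := boolP (z \in L).
  rewrite !orbF; case: ifP => Lx; case: ifP => Ly //; last exact: mulIg.
    by move=> eqx; rewrite eqx groupMr ?Ly in Lx.
  by move=> eqy; rewrite -eqy groupMr ?Lx in Ly.
by rewrite !orbT.
Qed.

Lemma card_not_DRR : abelian [set: gT] ->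
  #|[set S : {set gT} | ~~ is_DRR S]|
    <= (#|gT| ^ k + #|gT| ^ k * #|gT|) * 2 ^ (3 * #|gT| %/ 4).
Proof.
move=> abT; pose inv (s : {perm gT}) :=
  [set S : {set gT} | [forall x, (s x \in S) == (x \in S)]].
pose shift u := perm (@coset_shift_inj u).
pose U := [set u : {group gT} * gT |
            [&& u.1 \proper [set: gT], u.2 \in u.1 & u.2 != 1]].
(* Every permutation in [F] fixes exactly a proper subgroup, hence at most half of the points. The
   two pieces of [F] give the two summands of the bound. *)
pose F := (Aut [set: gT])^# :|: shift @: U.
have fixF s : s \in F -> #|[set x | s x == x]| * 2 <= #|gT|.
  case/setUP=> [/setD1P[nts As]|/imsetP[[L z]]].
    pose E := Group (Aut_equalizer_group_set As (group1 (Aut_group [set: gT]))).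
    have -> : [set x | s x == x] = E by apply/setP=> x; rewrite !inE perm1.
    apply: card_proper_subgroup; rewrite properE subsetT.
    apply: contra nts => /subsetP sE; apply/eqP/permP=> x.
    by have := sE x; rewrite !inE => /(_ isT)/eqP.
  rewrite inE => /and3P[/= prL Lz ntz] ->.
  have -> : [set x | shift (L, z) x == x] = L; last exact: card_proper_subgroup.
  apply/setP=> x; rewrite inE permE /coset_shift /= Lz orbF.
  case: ifP => [_|nLx]; first by rewrite eqxx.
  by apply/negbTE; apply: contra ntz => /eqP eqx; rewrite -(mulKg x z) eqx mulVg.
have cover : [set S : {set gT} | ~~ is_DRR S] \subset \bigcup_(s in F) inv s.
  apply/subsetP=> S; rewrite inE => /(not_DRR_symmetry abT).
  case=> [[p Ap pS]|[L [z [prL Lz ntz zS]]]]; apply/bigcupP.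
    by exists p; [rewrite inE Ap | rewrite inE; apply/forallP=> x; rewrite pS].
  exists (shift (L, z)); first by rewrite inE imset_f ?orbT // inE prL Lz.
  rewrite inE; apply/forallP=> x; rewrite permE /coset_shift /= Lz orbF.
  by case: ifPn => // /zS->.
apply: leq_trans (subset_leq_card cover) _.
have cardU : #|\bigcup_(s in F) inv s| <= \sum_(s in F) #|inv s|.
  elim/big_rec2: _ => [|s m M _ le]; first by rewrite cards0.
  by rewrite (leq_trans (leq_card_setU _ _)) // leq_add2l.
apply: leq_trans cardU _.
apply: (@leq_trans (\sum_(s in F) 2 ^ (3 * #|gT| %/ 4))).
  by apply: leq_sum => s Fs; apply: card_invariant_sets_le; apply: fixF.
rewrite sum_nat_const leq_mul2r (leq_trans (leq_card_setU _ _)) ?orbT // leq_add //.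
  exact: leq_trans (subset_leq_card (subsetDl _ _)) (card_Aut_le gT).
apply: leq_trans (leq_imset_card _ _) _; apply: leq_trans (max_card _) _.
by rewrite card_prod leq_mul2r card_subgroups_le orbT.
Qed.
End CountingNonDRR.

(* [Reals] shadows names such as [Morphism] used above; it also hides the nat
   notations, which the second import restores. *)
From Stdlib Require Import Reals Lra.
From mathcomp Require Import ssrnat.

(** * Passage to the real exponent *)

Section RealBounds.
Local Open Scope R_scope.

Lemma INR_leq (m n : nat) : (m <= n)%N -> INR m <= INR n.
Proof. by move/leP; apply: le_INR. Qed.

Lemma INR_expn (m n : nat) : INR (m ^ n)%N = INR m ^ n.
Proof. by elim: n => [|n IHn]; rewrite ?expn0 // expnS -multE mult_INR IHn. Qed.

(** The factors are bounded by [n ^ k <= 2 ^ (l ^ 2)] and [1 + n <= 2 * n = 2 ^ (l + 1)]; the spare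
    [l] is absorbed by a second [l ^ 2]. *)
Lemma counting_bound_real (n : nat) : (0 < n)%N ->
  INR ((n ^ trunc_log 2 n + n ^ trunc_log 2 n * n) * 2 ^ (3 * n %/ 4))
    <= Rpower 2 (3 * INR n / 4 + 2 * (log2R (INR n)) ^ 2 + 1).
Proof.
move=> n_gt0; set k := trunc_log 2 n; set m := (3 * n %/ 4)%N; set l := log2R (INR n).
have N1 : 1 <= INR n by apply: (INR_leq n_gt0).
have ln2 : 0 < ln 2 by rewrite -ln_1; apply: ln_increasing; lra.
have lE : ln (INR n) = l * ln 2 by rewrite /l /log2R; field; lra.
have N2l : INR n = Rpower 2 l by rewrite /Rpower -lE exp_ln //; lra.
have le_kl : INR k <= l.
  apply: (Rmult_le_reg_r (ln 2)) => //; rewrite -lE -ln_pow; last lra.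
  have : 2 ^ k <= INR n.
    by rewrite -[2]/(INR 2) -INR_expn; apply: INR_leq; rewrite trunc_logP.
  case=> [lt2k|->]; last exact: Rle_refl.
  by left; apply: ln_increasing => //; apply: pow_lt; lra.
have l_ge0 : 0 <= l by apply: Rle_trans le_kl; apply: pos_INR.
(* This would fail for [0 < l < 1], but [n] is an integer: either [n = 1] and [l = 0], or [n >= 2]
   and [l >= 1]. *)
have le_ll2 : l <= l ^ 2.
  move: n_gt0; rewrite leq_eqVlt => /orP[/eqP n1|n2].
    have -> : l = 0 by rewrite /l -n1 /log2R ln_1; field; lra.
    lra.
  suff : 1 <= l by nra.
  apply: Rle_trans le_kl; apply: (INR_leq (m := 1)).
  by rewrite trunc_log_gt0 /=.
have le_m : INR m <= 3 * INR n / 4.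
  have : INR (m * 4) <= INR (3 * n) by apply: INR_leq; rewrite leq_divM.
  rewrite -!multE !mult_INR /=; lra.
have nk : INR n ^ k <= Rpower 2 (l ^ 2).
  rewrite -Rpower_pow; last lra.
  rewrite {1}N2l Rpower_mult; apply: Rle_Rpower; [lra | nra].
have n1 : 1 + INR n <= Rpower 2 (l + 1).
  rewrite Rpower_plus -N2l Rpower_1; lra.
have m2 : INR 2 ^ m <= Rpower 2 (3 * INR n / 4).
  by rewrite -Rpower_pow /=; [apply: Rle_Rpower; lra | lra].
rewrite -multE -plusE !mult_INR plus_INR mult_INR !INR_expn.
have nk_ge0 : 0 <= INR n ^ k by apply: pow_le; lra.
have m2_ge0 : 0 <= INR 2 ^ m by apply: pow_le; apply: pos_INR.
have -> : INR n ^ k + INR n ^ k * INR n = INR n ^ k * (1 + INR n) by ring.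
apply: (Rle_trans _ (Rpower 2 (l ^ 2) * Rpower 2 (l + 1) * Rpower 2 (3 * INR n / 4))).
  apply: Rmult_le_compat => //; first by apply: Rmult_le_pos; lra.
  by apply: Rmult_le_compat => //; lra.
rewrite -!Rpower_plus; apply: Rle_Rpower; lra.
Qed.
End RealBounds.

Theorem theorem1p4 (gT : finGroupType) (habel : abelian [set: gT]) :
  (INR #|[set S : {set gT} | ~~ is_DRR S]|
   <= Rpower 2 (3 * INR #|gT| / 4 + 2 * (log2R (INR #|gT|)) ^ 2 + 1))%R.
Proof.
apply: (Rle_trans _ _ _ (INR_leq (card_not_DRR habel))).
by apply: counting_bound_real; apply/card_gt0P; exists 1%g.
Qed.
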